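(* Let $n,k\in\mathbb{N}$, let $\mathbf{a}^{1},\dots,\mathbf{a}^{k}\in\mathbb{R}^{n}$ be pairwise linearly independent vectors, and let $f\in C(\mathbb{R}^{n})$ be a function of the form $$f(\mathbf{x})=\sum_{i=1}^{k}f_{i}(\mathbf{a}^{i}\cdot\mathbf{x}),\qquad \mathbf{x}\in\mathbb{R}^{n},$$ where $f_{1},\dots,f_{k}:\mathbb{R}\to\mathbb{R}$ are arbitrary functions (no regularity assumed). Then there exist continuous functions $g_{i}:\mathbb{R}\to\mathbb{R}$, $i=1,\dots,k$, and a polynomial $P:\mathbb{R}^{n}\to\mathbb{R}$ of (total) degree at most $k-1$ such that $$f(\mathbf{x})=\sum_{i=1}^{k}g_{i}(\mathbf{a}^{i}\cdot\mathbf{x})+P(\mathbf{x})\qquad\text{for all }\mathbf{x}\in\mathbb{R}^{n}.$$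
   Context: All functions are real-valued. $\mathbf{a}\cdot\mathbf{x}$ denotes the standard inner product on $\mathbb{R}^{n}$, and $C(\mathbb{R}^{n})$ is the class of continuous functions on $\mathbb{R}^{n}$. *)

(* Defs.v *)
From HB Require Import structures.
From mathcomp Require Import all_boot all_order all_algebra.
From mathcomp Require Import boolp classical_sets reals topology normedtype.
(* The notations of mpoly clash with those of the analysis library. *)
From mathcomp Require Import -(notations) mpoly.

Set Implicit Arguments.
Unset Strict Implicit.
Unset Printing Implicit Defensive.

Import GRing.Theory Num.Theory numFieldNormedType.Exports.

Local Open Scope ring_scope.

Definition dotv (R : realType) (n : nat) (a x : 'rV[R]_n) : R :=
  \sum_(j < n) a ord0 j * x ord0 j.

Definition pairwise_independent (R : realType) (n k : nat)
    (a : 'I_k -> 'rV[R]_n) : Prop :=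
  forall i j : 'I_k, i != j -> free [:: a i; a j].

Definition polyfun (R : realType) (n : nat) (P : mpoly n R)
    (x : 'rV[R]_n) : R :=
  meval (fun j : 'I_n => x ord0 j) P.

(* [mpoly.msize P] is 1 + the total degree of P, and 0 for P = 0, so this says
   that P has total degree at most k - 1 (and P = 0 when k = 0). *)
Definition tdegree_lt (R : realType) (n k : nat) (P : mpoly n R) : Prop :=
  (mpoly.msize P <= k)%N.

(* Main.v *)
Require Import Defs.
From HB Require Import structures.
From mathcomp Require Import all_boot all_order all_algebra.
From mathcomp Require Import boolp classical_sets reals topology normedtype.
From mathcomp Require Import functions derive realfun.
From mathcomp Require Import measure lebesgue_measure lebesgue_integral ftc.
From mathcomp Require Import ring lra.
From mathcomp Require Import -(notations) mpoly.

(* Restrict f to a plane on which the directions remain pairwise independent.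
   There it is killed by a product of k differences, one along the level line of
   each ridge.  Let U be the mean of the differences f(. + t c) - f over t in
   [0, 1], and v = f(. + c) - f, where c is one of these directions; U and v are
   continuous and killed by the k - 1 other differences.  As f + U is the mean of
   f over [x, x + c], its increments along c are integrals of v.  By induction on
   k, the restriction is a sum of continuous ridge functions G_i, and no
   polynomial is needed.  The same differences show that each f_i - G_i
   is killed by all products of k - 1 differences, hence so is the continuous
   function f - sum g_i(a^i . x) on R^n, where g_i is G_i rescaled.  Such
   a function is a polynomial of degree less than k - 1, by the same averaging
   along the coordinate axes.  *)

Set Implicit Arguments.
Unset Strict Implicit.
Unset Printing Implicit Defensive.

Import Order.TTheory GRing.Theory Num.Theory numFieldNormedType.Exports.

Local Open Scope ring_scope.
Local Open Scope classical_set_scope.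

(** * Primitives of continuous functions *)

Lemma comp_continuous (S T U : topologicalType) (f : S -> T) (g : T -> U) :
  continuous f -> continuous g -> continuous (fun x => g (f x)).
Proof.
by move=> fc gc x; exact: (@continuous_comp S T U f g x (fc x) (gc _)).
Qed.

Lemma pair_continuous (S T U : topologicalType) (f : S -> T) (g : S -> U) :
  continuous f -> continuous g -> continuous (fun x => (f x, g x)).
Proof. by move=> fc gc x; apply: cvg_pair; [exact: fc|exact: gc]. Qed.

Section Primitive.
Variable R : realType.
Implicit Types (g h F G : R -> R) (k : R).

(* continuous_FTC1_closed differentiates the integral from a fixed base point
   only to its right, so primitives on the whole line are glued at 0. *)
Lemma exists_primitive_half g : continuous g -> (forall x, x <= 0 -> g x = 0) ->
  exists F, forall x : R, is_derive x 1 F (g x).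
Proof.
move=> gc g0.
pose F y := (\int[@lebesgue_measure R]_(t in `[(-1)%R, y]) (g t))%R.
exists F => x.
(* Above -1/2 the point lies strictly to the right of the base point -1, so the fundamental theorem
   applies; below -1/2 the integrand vanishes on the whole interval, so [F] is locally 0. *)
have [xlt|xge] := ltP x (-2^-1).
  rewrite g0; last by lra.
  apply: (@near_eq_is_derive _ _ _ (cst 0)).
    near=> y; rewrite /F.
    have -> : (\int[@lebesgue_measure R]_(t in `[(-1)%R, y]) (g t))%R =
              (\int[@lebesgue_measure R]_(t in `[(-1)%R, y]) (cst 0 t))%R.
      apply: eq_Rintegral => t; rewrite inE /= in_itv /= => /andP[_ ty].
      rewrite g0 //; apply: le_trans ty _.
      have : y < - 2^-1 by near: y; exact: lt_nbhsl.
      by lra.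
    by rewrite Rintegral_cst // mul0r.
have [] := @continuous_FTC1_closed R g (-1) x (x + 1) _ _ _ (gc x).
- by lra.
- apply: continuous_compact_integrable; first exact: segment_compact.
  exact: continuous_subspaceT.
- by lra.
by move=> dF F'; apply: DeriveDef; [exact: dF|rewrite -derive1E].
Unshelve. all: by end_near. Qed.

(** Write g x as (g (max x 0) - g 0) + (g (- max (- x) 0) - g 0) + g 0. The first bracket vanishes
    for x <= 0, the second does so after the reflection x -> - x, and the constant has a linear
    primitive. *)
Lemma exists_primitive g : continuous g ->
  exists F, forall x : R, is_derive x 1 F (g x).
Proof.
move=> gc.
have half (h : R -> R) : continuous h ->
    exists F, forall x : R, is_derive x 1 F (h (Num.max x 0) - h 0).
  move=> hc; apply: exists_primitive_half => [|x x0]; last first.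
    by rewrite (elimT max_idPr x0) subrr.
  have hm : continuous (fun x : R => h (Num.max x 0)).
    apply: (@comp_continuous R R R (fun x : R => Num.max x 0) h) => // x.
    exact: (@continuous_max R R (id : R -> R) (cst (0 : R))
              x cvg_id (cvg_cst _)).
  by move=> x; apply: cvgB; [exact: hm|exact: cvg_cst].
have [F1 dF1] := half _ gc.
have [F2 dF2] : exists F,
    forall x : R, is_derive x 1 F (g (- Num.max x 0) - g (- 0)).
  apply: (half (fun t => g (- t))).
  by apply: (@comp_continuous R R R -%R g) => //; exact: opp_continuous.
exists (F1 - (F2 \o -%R) + (g 0 \*: id)) => x.
have d2 : is_derive x 1 (F2 \o -%R) ((g (- Num.max (- x) 0) - g (- 0)) * (- 1)).
  by apply: is_derive1_comp; exact: is_deriveNid.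
have d3 : is_derive x 1 (g 0 \*: id) (g 0 *: 1 : R) by exact: is_deriveZ.
have d4 := is_deriveB (dF1 x) d2.
have d5 := is_deriveD d4 d3.
apply: (is_derive_eq d5).
rewrite oppr0 /GRing.scale /= mulr1.
case: (leP x 0) => x0.
  rewrite (elimT max_idPl _) ?oppr_ge0 // opprK; ring.
rewrite (elimT max_idPr _) ?oppr_le0 ?ltW // oppr0; ring.
Qed.


(* The primitive of g vanishing at 0; junk when g has no primitive. *)
Definition primitive g : R -> R :=
  xget (cst 0) [set F | F 0 = 0 /\ forall x : R, is_derive x 1 F (g x)].

Lemma primitiveP g : continuous g ->
  primitive g 0 = 0 /\ forall x : R, is_derive x 1 (primitive g) (g x).
Proof.
move=> gc; rewrite /primitive; case: xgetP => [F _ //|noF].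
have [F dF] := exists_primitive gc.
exfalso; apply: (noF (F - cst (F 0))); split.
  by rewrite /= /GRing.add /= subrr.
move=> x; have d := is_deriveB (dF x) (is_derive_cst (F 0) x 1).
by apply: (is_derive_eq d); rewrite subr0.
Qed.

Lemma primitive_at0 g : continuous g -> primitive g 0 = 0.
Proof. by case/primitiveP. Qed.

Lemma is_derive_primitive g (x : R) : continuous g ->
  is_derive x 1 (primitive g) (g x).
Proof. by case/primitiveP. Qed.

(** Two primitives differ by a function of zero derivative. The identities below are obtained from
    this by exhibiting an antiderivative of the integrand. *)
Lemma primitive_unique g F (x : R) : continuous g ->
  (forall t : R, is_derive t 1 F (g t)) -> primitive g x = F x - F 0.
Proof.
move=> gc dF; have [P0 dP] := primitiveP gc.
have d0 t : is_derive t (1 : R) (primitive g - F) 0.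
  by apply: (is_derive_eq (is_deriveB (dP t) (dF t))); rewrite subrr.
have := is_derive_0_is_cst x 0 d0.
rewrite /GRing.add /= /GRing.opp /= P0 sub0r => /eqP.
by rewrite subr_eq => /eqP ->; rewrite addrC.
Qed.

Lemma primitive_continuous g : continuous g -> continuous (primitive g).
Proof.
move=> gc x; apply: differentiable_continuous; apply/derivable1_diffP.
by have [] := is_derive_primitive x gc.
Qed.

Lemma primitive_lincomb g h k (x : R) : continuous g -> continuous h ->
  primitive (fun t => g t + k * h t) x = primitive g x + k * primitive h x.
Proof.
move=> gc hc.
have ghc : continuous (fun t => g t + k * h t).
  move=> t; apply: cvgD; first exact: gc.
  by apply: cvgM; [exact: cvg_cst|exact: hc].
have d t :
    is_derive t (1 : R) (primitive g + k \*: primitive h) (g t + k * h t).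
  have dh := is_deriveZ k (is_derive_primitive t hc).
  exact: (is_derive_eq (is_deriveD (is_derive_primitive t gc) dh)).
rewrite (primitive_unique x ghc d).
rewrite -[LHS]/(primitive g x + k * primitive h x -
  (primitive g 0 + k * primitive h 0)).
by rewrite !primitive_at0 // mulr0 addr0 subr0.
Qed.

Lemma primitive_cst0 (x : R) : primitive (fun=> 0) x = 0.
Proof.
have d t : is_derive t (1 : R) (cst 0 : R -> R) 0 by exact: is_derive_cst.
by rewrite (primitive_unique x _ d) ?subrr //; exact: cst_continuous.
Qed.

Lemma primitiveB g h (x : R) : continuous g -> continuous h ->
  primitive (fun t => g t - h t) x = primitive g x - primitive h x.
Proof.
move=> gc hc; rewrite -mulN1r -primitive_lincomb //; congr (primitive _ x).
by apply/funext => t; rewrite mulN1r.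
Qed.

Lemma primitive_sum (I : Type) (r : seq I) (G : I -> R -> R) (x : R) :
  (forall i, continuous (G i)) ->
  primitive (fun t => \sum_(i <- r) G i t) x = \sum_(i <- r) primitive (G i) x.
Proof.
move=> Gc; elim: r => [|i r IH].
  rewrite big_nil -[RHS](primitive_cst0 x); congr (primitive _ x).
  by apply/funext => t; rewrite big_nil.
rewrite big_cons -IH -[X in _ + X]mul1r -primitive_lincomb //.
  by congr (primitive _ x); apply/funext => t; rewrite big_cons mul1r.
apply: continuous_big => [|{}i _]; [exact: add_continuous|exact: Gc].
Qed.

Lemma affine_continuous (a b : R) : continuous (fun t : R => a + b * t).
Proof.
move=> t; apply: cvgD; first exact: cvg_cst.
by apply: cvgM; [exact: cvg_cst|exact: cvg_id].
Qed.

Lemma is_derive_affine (a b t : R) : is_derive t 1 (cst a + b \*: id) b.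
Proof.
have d := is_deriveD (is_derive_cst a t 1) (is_deriveZ b (is_derive_id t 1)).
by apply: (is_derive_eq d); rewrite add0r /GRing.scale /= mulr1.
Qed.

(** Change of variables, by the chain rule. The factor [b] is kept on the left so that [b = 0] is
    allowed. *)
Lemma primitive_affine g (a b x : R) : continuous g ->
  b * primitive (fun t => g (a + b * t)) x =
  primitive g (a + b * x) - primitive g a.
Proof.
move=> gc.
have gac : continuous (fun t => g (a + b * t)).
  exact: (comp_continuous (@affine_continuous a b) gc).
have -> : b * primitive (fun t => g (a + b * t)) x =
    primitive (fun t => b * g (a + b * t)) x.
  rewrite -[LHS]add0r -[X in X + _](primitive_cst0 x) -primitive_lincomb //.
    by congr (primitive _ x); apply/funext => t; rewrite add0r.
  exact: cst_continuous.
have d t : is_derive t (1 : R) (primitive g \o (cst a + b \*: id))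
    (b * g (a + b * t)).
  have dg := is_derive_primitive ((cst a + b \*: id) t) gc.
  apply: (is_derive_eq (is_derive1_comp dg (is_derive_affine a b t))).
  by rewrite mulrC.
rewrite (primitive_unique x _ d); last first.
  by move=> t; apply: cvgM; [exact: cvg_cst|exact: gac].
rewrite -[LHS]/(primitive g (a + b * x) - primitive g (a + b * 0)).
by rewrite mulr0 addr0.
Qed.

Lemma primitive_split g (s x : R) : continuous g ->
  primitive (fun t => g (s + t)) x = primitive g (s + x) - primitive g s.
Proof.
move=> gc; have := primitive_affine s 1 x gc; rewrite !mul1r => <-.
by under [in RHS]eq_fun do rewrite mul1r.
Qed.

Lemma primitive_monomial (c x : R) n :
  primitive (fun t => c * t ^+ n) x = c / n.+1%:R * x ^+ n.+1.
Proof.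
have d t : is_derive t (1 : R) ((c / n.+1%:R) \*: (id ^+ n.+1)) (c * t ^+ n).
  have dX := is_deriveX n.+1 (is_derive_id t 1).
  apply: (is_derive_eq (is_deriveZ (c / n.+1%:R) dX)).
  by rewrite /GRing.scale /= mulr1 mulrA divfK // pnatr_eq0.
rewrite (primitive_unique x _ d); last first.
  move=> t; apply: cvgM; first exact: cvg_cst.
  exact: exprn_continuous.
rewrite -[LHS]/(c / n.+1%:R * (id ^+ n.+1) x - c / n.+1%:R * (id ^+ n.+1) 0).
by rewrite !exprfctE /= expr0n mulr0 subr0.
Qed.

(** By the mean value theorem, [primitive g 1] is a value of [g] on [0, 1]. *)
Lemma primitive_le g (e : R) : continuous g ->
  (forall t, 0 <= t <= 1 -> `|g t| <= e) -> `|primitive g 1| <= e.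
Proof.
move=> gc ge.
have [|||c c01] := @MVT_segment R (primitive g) g 0 1.
- exact: ler01.
- by move=> x _; exact: is_derive_primitive.
- by apply: continuous_subspaceT; exact: primitive_continuous.
by rewrite primitive_at0 // !subr0 mulr1 => ->; apply: ge; move: c01; rewrite in_itv.
Qed.

Lemma uncurry_continuous_r (T : topologicalType) (Phi : T -> R -> R) (x : T) :
  continuous (fun p : T * R => Phi p.1 p.2) -> continuous (Phi x).
Proof.
move=> Phic.
apply: (@comp_continuous R (T * R)%type R (fun t => (x, t)) _ _ Phic).
by apply: pair_continuous => t; [exact: cvg_cst|exact: cvg_id].
Qed.

(** By compactness of [0, 1], for [y] near [x] the functions [Phi x] and [Phi y] are close uniformly
    on [0, 1]; hence so are their integrals. *)
Lemma parametric_primitive_continuous (T : topologicalType) (Phi : T -> R -> R) :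
  continuous (fun p : T * R => Phi p.1 p.2) ->
  continuous (fun x => primitive (Phi x) 1).
Proof.
move=> Phic x; apply/cvgrPdist_le => e e0.
have cov : \forall y \near x, `[0, 1] `<=` [set t | `|Phi x t - Phi y t| <= e].
  have /compact_near_coveringP/(_ T (nbhs x)) := @segment_compact R 0 1.
  apply => t _.
  have dc : continuous (fun p : R * T => Phi x p.1 - Phi p.2 p.1).
    move=> p; apply: cvgB.
      apply: (@comp_continuous _ _ _ fst (Phi x)) => [q|]; first exact: cvg_fst.
      exact: uncurry_continuous_r.
    apply: (@comp_continuous _ _ _ (fun q : R * T => (q.2, q.1)) _ _ Phic).
    by apply: pair_continuous => q; [exact: cvg_snd|exact: cvg_fst].
  have /cvgrPdist_le/(_ e e0) := dc (t, x).
  by rewrite /= subrr; apply: filterS => p; rewrite sub0r normrN.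
near=> y.
rewrite -primitiveB; [|exact: uncurry_continuous_r|exact: uncurry_continuous_r].
apply: primitive_le.
  by move=> t; apply: cvgB; exact: uncurry_continuous_r.
move=> t t01; have := near cov y; apply => //=.
Unshelve. all: by end_near. Qed.

End Primitive.

(** * Difference operators *)

Section Difference.
Variable R : realType.

Definition fdiff (V : zmodType) (h : V) (f : V -> R) (x : V) : R :=
  f (x + h) - f x.

(** Two instances matter. With the level lines of ridges it is the equation satisfied by sums of
    these ridges; with [nseq m setT] it is the Fréchet equation, whose continuous solutions on R^n
    are the polynomials of degree less than m. *)
Fixpoint annihilated (V : zmodType) (Ds : seq (set V)) (f : V -> R) : Prop :=
  if Ds is D :: Ds' then forall h, D h -> annihilated Ds' (fdiff h f)
  else forall x, f x = 0.

Lemma annihilated0 (V : zmodType) (Ds : seq (set V)) : annihilated Ds (fun=> 0).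
Proof.
elim: Ds => //= D Ds IH h _.
by rewrite (_ : fdiff h _ = fun=> 0) //; apply/funext => x; rewrite /fdiff subrr.
Qed.

Lemma annihilatedD (V : zmodType) (Ds : seq (set V)) (f g : V -> R) :
  annihilated Ds f -> annihilated Ds g -> annihilated Ds (fun x => f x + g x).
Proof.
elim: Ds f g => [|D Ds IH] f g /= fD gD; first by move=> x; rewrite fD gD addr0.
move=> h Dh; rewrite (_ : fdiff h _ = fun x => fdiff h f x + fdiff h g x).
  by apply: IH; [exact: fD|exact: gD].
by apply/funext => x; rewrite /fdiff; ring.
Qed.

Lemma annihilated_sum (V : zmodType) (Ds : seq (set V)) (I : Type) (r : seq I)
    (F : I -> V -> R) :
  (forall i, annihilated Ds (F i)) ->
  annihilated Ds (fun x => \sum_(i <- r) F i x).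
Proof.
move=> FD; elim: r => [|i r IH].
  rewrite (_ : (fun=> _) = fun=> 0); first exact: annihilated0.
  by apply/funext => x; rewrite big_nil.
rewrite (_ : (fun=> _) = fun x => F i x + \sum_(j <- r) F j x).
  exact: annihilatedD.
by apply/funext => x; rewrite big_cons.
Qed.

(** Differences in [x] commute with integration over [t]. *)
Lemma annihilated_primitive (V : zmodType) (Ds : seq (set V))
    (Phi : R -> V -> R) :
  (forall x, continuous (Phi^~ x)) -> (forall t, annihilated Ds (Phi t)) ->
  annihilated Ds (fun x => primitive (Phi^~ x) 1).
Proof.
elim: Ds Phi => [|D Ds IH] Phi Phic /= PhiD.
  move=> x; rewrite -[RHS](primitive_cst0 1); congr (primitive _ 1).
  by apply/funext => t; exact: PhiD.
move=> h Dh.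
rewrite (_ : fdiff h _ = fun x => primitive ((fun t => fdiff h (Phi t))^~ x) 1).
  apply: IH => [x|t]; last exact: PhiD.
  by move=> t; apply: cvgB; exact: Phic.
by apply/funext => x; rewrite /fdiff primitiveB //.
Qed.

Lemma annihilated_comp (V W : zmodType) (m : nat) (L : V -> W) (p : W -> R) :
  {morph L : x y / x + y} -> annihilated (nseq m setT) p ->
  annihilated (nseq m setT) (fun x => p (L x)).
Proof.
move=> LD; elim: m p => [|m IH] p pD /=; first by move=> x; exact: pD.
move=> h _; rewrite (_ : fdiff h _ = fun x => fdiff (L h) p (L x)).
  by apply: IH; exact: (pD (L h) I).
by apply/funext => x; rewrite /fdiff LD.
Qed.

Variable V : normedModType R.
Implicit Types (f : V -> R) (c x : V).

Lemma line_continuous c x : continuous (fun t : R => x + t *: c).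
Proof.
move=> t; apply: cvgD; first exact: cvg_cst.
by apply: cvgZr_tmp; exact: cvg_id.
Qed.

Lemma translate_continuous c f : continuous f -> continuous (fun x => f (x + c)).
Proof.
move=> fc; apply: (@comp_continuous V V R (fun x => x + c) f) => // x.
by apply: cvgD; [exact: cvg_id|exact: cvg_cst].
Qed.

Lemma fdiff_continuous c f : continuous f -> continuous (fdiff c f).
Proof.
by move=> fc x; apply: cvgB; [exact: (translate_continuous fc)|exact: fc].
Qed.

(** As [primitive] vanishes at 0, its value at 1 is the integral over [0, 1]. *)
Definition mean_fdiff c f x : R := primitive (fun t => fdiff (t *: c) f x) 1.

Lemma fdiff_line_continuous c f : continuous f ->
  continuous (fun p : V * R => fdiff (p.2 *: c) f p.1).
Proof.
move=> fc p; apply: cvgB; last first.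
  by apply: (@comp_continuous _ _ _ fst f) => // q; exact: cvg_fst.
apply: (@comp_continuous (V * R)%type V R (fun q => q.1 + q.2 *: c) f) => // q.
apply: cvgD; first exact: cvg_fst.
by apply: cvgZr_tmp; exact: cvg_snd.
Qed.

Lemma mean_fdiff_continuous c f : continuous f -> continuous (mean_fdiff c f).
Proof.
move=> fc.
apply: (@parametric_primitive_continuous R V (fun x t => fdiff (t *: c) f x)).
exact: fdiff_line_continuous.
Qed.

(** Averaging uses up one set of the list, because every step [t *: c] in the average lies in
    [D]. *)
Lemma annihilated_mean_fdiff (Ds : seq (set V)) (D : set V) c f :
  continuous f -> (forall t : R, D (t *: c)) ->
  annihilated (D :: Ds) f -> annihilated Ds (mean_fdiff c f).
Proof.
move=> fc Dc fD; apply: annihilated_primitive => [x|t].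
  apply: (@uncurry_continuous_r R V (fun x t => fdiff (t *: c) f x)).
  exact: fdiff_line_continuous.
exact: fD.
Qed.

(* Along the line, f + mean_fdiff c f is the mean of f over [x, x + c], whose
   increments are integrals of fdiff c f. *)
Lemma line_formula c f x (s : R) : continuous f ->
  f (x + s *: c) = f x + mean_fdiff c f x - mean_fdiff c f (x + s *: c) +
    primitive (fun t => fdiff c f (x + t *: c)) s.
Proof.
move=> fc; pose g t := f (x + t *: c).
have gc : continuous g by exact: (comp_continuous (@line_continuous c x)).
have sc (a : R) : continuous (fun t => g (a + t)).
  apply: (@comp_continuous R R R (fun t => a + t) g) => // t.
  by apply: cvgD; [exact: cvg_cst|exact: cvg_id].
have cc (a : R) : continuous (fun _ : R => a) by exact: cst_continuous.
have pcst (a b : R) : primitive (fun=> a) b = a * b.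
  rewrite -[in RHS](expr1 b) -[X in X * _]divr1 -(primitive_monomial _ _ 0).
  by congr (primitive _ _); apply/funext => t; rewrite mulr1.
(* The difference of primitives is the mean of [f] over the segment from x + a c to x + (a + 1) c.
   The formula follows by comparing a = 0 with a = s. *)
have mE (a : R) : mean_fdiff c f (x + a *: c) =
    primitive g (a + 1) - primitive g a - g a.
  rewrite -primitive_split // -[g a in RHS]mulr1 -pcst -primitiveB //.
  congr (primitive _ _); apply/funext => t; rewrite /g /fdiff.
  by rewrite scalerDl addrA.
have m0 := mE 0; rewrite scale0r addr0 add0r (primitive_at0 gc) subr0 in m0.
rewrite m0 mE.
have -> : primitive (fun t => fdiff c f (x + t *: c)) s =
    primitive (fun t => g (1 + t) - g t) s.
  congr (primitive _ _); apply/funext => t; rewrite /g /fdiff.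
  by rewrite scalerDl scale1r [c + _]addrC addrA.
rewrite primitiveB // primitive_split //.
rewrite /g scale0r addr0 (addrC 1 s); ring.
Qed.

End Difference.

(** * Ridge functions on the plane *)

Section PlaneRidge.
Variables (R : realType) (I : eqType) (lam : I -> R).
Hypothesis lam_inj : injective lam.

(** With the first coefficient normalised to 1, pairwise independence of the directions becomes
    injectivity of [lam], and all tilts agree on the axis [p.2 = 0]. *)
Definition tilt (i : I) (p : R * R) : R := p.1 + lam i * p.2.

(** The kernel of [tilt i], parametrised by its second coordinate. *)
Definition level_line (i : I) : set (R * R) :=
  [set h | exists t : R, h = (- (t * lam i), t)].

Lemma tilt_shift (i j : I) (p : R * R) (t : R) :
  tilt i (p + (- (t * lam j), t)) = tilt i p + t * (lam i - lam j).
Proof. by rewrite /tilt /=; ring. Qed.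

(** A step along the level line of [j] cancels the ridge of [j] and turns every other [phi i] into
    one of its differences, which leaves a ridge sum over [r]. *)
Lemma ridge_annihilated (r : seq I) (phi : I -> R -> R) :
  annihilated (map level_line r) (fun p => \sum_(i <- r) phi i (tilt i p)).
Proof.
elim: r phi => [|j r IH] phi /=; first by move=> p; rewrite big_nil.
move=> _ [t ->].
rewrite (_ : fdiff _ _ = fun p =>
  \sum_(i <- r) fdiff (t * (lam i - lam j)) (phi i) (tilt i p)).
  exact: (IH (fun i => fdiff (t * (lam i - lam j)) (phi i))).
apply/funext => p; rewrite /fdiff !big_cons !tilt_shift subrr mulr0 addr0.
rewrite opprD addrACA subrr add0r -sumrB.
by apply: eq_bigr => i _; rewrite tilt_shift.
Qed.

(* Each difference along a level line removes one of the other ridges, and by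
   lam_inj its effect on phi j is a difference with arbitrary step. *)
Lemma vanishing_ridge_sum (j : I) (r : seq I) (phi : I -> R -> R) :
  uniq (j :: r) ->
  (forall p, \sum_(i <- j :: r) phi i (tilt i p) = 0) ->
  annihilated (nseq (size r) setT) (phi j).
Proof.
elim: r phi => [|l r IH] phi /=.
  by move=> _ phi0 y; have := phi0 (y, 0); rewrite big_seq1 /tilt /= mulr0 addr0.
rewrite inE negb_or => /andP[/andP[jl jr] /andP[lr ur]] phi0 h _.
have jl0 : lam j - lam l != 0.
  by rewrite subr_eq0; apply: contra jl => /eqP /lam_inj ->.
pose t := h / (lam j - lam l).
rewrite -[h](divfK jl0) -/t.
apply: (IH (fun i => fdiff (t * (lam i - lam l)) (phi i))); first by rewrite /= jr.
move=> p; have := phi0 (p + (- (t * lam l), t)).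
rewrite -[RHS](phi0 p) => /eqP; rewrite -subr_eq0 => /eqP.
rewrite -sumrB !big_cons !tilt_shift (subrr (lam l)) mulr0 addr0 subrr add0r.
move=> e; rewrite -[RHS]e; congr (_ + _); apply: eq_bigr => i _.
by rewrite tilt_shift.
Qed.

(** By induction, the mean and the difference of [F] along the level line of [j] are continuous
    ridge sums over [r]. [line_formula] then recovers [F p] from the point where this line through
    [p] meets the axis: terms at that point depend on [tilt j p] alone, and the others are ridges
    over [r]. *)
Lemma continuous_plane_ridge (r : seq I) (F : R * R -> R) :
  uniq r -> continuous F -> annihilated (map level_line r) F ->
  exists G : I -> R -> R, (forall i, continuous (G i)) /\
    forall p, F p = \sum_(i <- r) G i (tilt i p).
Proof.
elim: r F => [|j r IH] F /=.
  move=> _ _ F0; exists (fun _ _ => 0); split=> [i|p]; first exact: cst_continuous.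
  by rewrite big_nil.
move=> /andP[jr ur] Fc FD.
pose c : R * R := (- lam j, 1).
have cE (t : R) : t *: c = (- (t * lam j), t).
  by rewrite -[LHS]/(t * - lam j, t * 1) mulr1 mulrN.
have jc (t : R) : level_line j (t *: c).
  by exists t; rewrite cE.
have [U [Uc UE]] := IH _ ur (mean_fdiff_continuous (c := c) Fc)
  (annihilated_mean_fdiff Fc jc FD).
have [W [Wc WE]] : exists G : I -> R -> R, (forall i, continuous (G i)) /\
    forall p, fdiff c F p = \sum_(i <- r) G i (tilt i p).
  apply: (IH _ ur (fdiff_continuous Fc)); apply: FD.
  by have := jc 1; rewrite scale1r.
have axis_continuous (H : R * R -> R) :
    continuous H -> continuous (fun y : R => H (y, 0)).
  move=> Hc; apply: (@comp_continuous _ _ _ (fun y : R => (y, 0 : R)) _ _ Hc).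
  by apply: pair_continuous => y; [exact: cvg_id|exact: cvg_cst].
(* Along [c], [tilt i] grows at rate [lam i - lam j], so integrating the ridge [W i] along the line
   divides by this rate. *)
pose A i y := (lam i - lam j)^-1 * primitive (W i) y.
have Ac i : continuous (A i).
  by move=> y; apply: cvgM; [exact: cvg_cst|exact: primitive_continuous].
exists (fun i => if i == j then
    fun y => F (y, 0) + mean_fdiff c F (y, 0) - \sum_(l <- r) A l y
  else fun y => A i y - U i y).
split=> [i|p].
  case: eqP => _ y.
    apply: cvgB.
      apply: cvgD; first exact: axis_continuous.
      by apply: axis_continuous; exact: mean_fdiff_continuous.
    by apply: continuous_big => [|{}i _]; [exact: add_continuous|exact: Ac].
  by apply: cvgB; [exact: Ac|exact: Uc].
(* The point of the axis on the level line of [j] through [p]. *)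
pose x : R * R := (tilt j p, 0).
have tx i t : tilt i (x + t *: c) = tilt j p + (lam i - lam j) * t.
  by rewrite cE tilt_shift {1}/tilt /x /= mulr0 addr0 mulrC.
have px : p = x + p.2 *: c.
  rewrite cE -[RHS]/(tilt j p - p.2 * lam j, 0 + p.2) /tilt mulrC addrK add0r.
  exact: surjective_pairing.
rewrite [in LHS]px line_formula // -px.
have -> : primitive (fun t => fdiff c F (x + t *: c)) p.2 =
    \sum_(i <- r) (A i (tilt i p) - A i (tilt j p)).
  rewrite (_ : (fun t => _) =
      fun t => \sum_(i <- r) W i (tilt j p + (lam i - lam j) * t)); last first.
    by apply/funext => t; rewrite WE; apply: eq_bigr => i _; rewrite tx.
  rewrite primitive_sum; last first.
    by move=> i; exact: (comp_continuous (@affine_continuous R _ _) (Wc i)).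
  apply: eq_big_seq => i ir.
  have ij : lam i - lam j != 0.
    by rewrite subr_eq0; apply: contraNneq jr => /lam_inj <-.
  rewrite /A -mulrBr; apply: (mulfI ij); rewrite mulVKf //.
  rewrite primitive_affine //; congr (primitive _ _ - _).
  by rewrite -tx -px.
rewrite big_cons eqxx !UE sumrB.
rewrite [X in _ = _ + X](eq_big_seq (fun i => A i (tilt i p) - U i (tilt i p))).
  by rewrite sumrB /x; ring.
by move=> i ir; rewrite ifN //; apply: contraNneq jr => <-.
Qed.

End PlaneRidge.

(** * Continuous functions killed by differences are polynomials *)

Section PolynomialFunctions.
Variables (R : realType) (n : nat).
Implicit Types (P Q : mpoly n R) (x y : 'rV[R]_n) (q : 'rV[R]_n -> R).

(** The bound [d] on the degree is strict, so that it matches the number of differences in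
    [nseq d setT]. *)
Definition is_polyfun (d : nat) q : Prop :=
  exists P, (mpoly.msize P <= d)%N /\ forall x, q x = polyfun P x.

Lemma is_polyfunD d q1 q2 : is_polyfun d q1 -> is_polyfun d q2 ->
  is_polyfun d (fun x => q1 x + q2 x).
Proof.
move=> [P1 [P1d qP1]] [P2 [P2d qP2]]; exists (P1 + P2); split=> [|x].
  by apply: leq_trans (mpoly.msizeD_le _ _) _; rewrite geq_max P1d P2d.
by rewrite qP1 qP2 /polyfun mpoly.mevalD.
Qed.

Lemma is_polyfunN d q : is_polyfun d q -> is_polyfun d (fun x => - q x).
Proof.
move=> [P [Pd qP]]; exists (- P); split=> [|x]; first by rewrite mpoly.msizeN.
by rewrite qP /polyfun mpoly.mevalN.
Qed.

Lemma is_polyfunZ d c q : is_polyfun d q -> is_polyfun d (fun x => c * q x).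
Proof.
move=> [P [Pd qP]]; exists (c *: P); split=> [|x].
  exact: leq_trans (mpoly.msizeZ_le _ _) Pd.
by rewrite qP /polyfun mpoly.mevalZ.
Qed.

Lemma is_polyfun0 d : is_polyfun d (fun=> 0).
Proof.
exists 0; split=> [|x]; first by rewrite mpoly.msize0.
by rewrite /polyfun mpoly.meval0.
Qed.

Lemma is_polyfun_leq d1 d2 q : (d1 <= d2)%N -> is_polyfun d1 q -> is_polyfun d2 q.
Proof. by move=> d12 [P [Pd qP]]; exists P; split=> //; exact: leq_trans d12. Qed.

Lemma is_polyfun_cst d c : is_polyfun d.+1 (fun=> c).
Proof.
exists (mpoly.mpolyC n c); split=> [|x].
  by rewrite mpoly.msizeC; case: (c != 0).
by rewrite /polyfun mpoly.mevalC.
Qed.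

Lemma is_polyfun_sum d (I : eqType) (r : seq I) (F : I -> 'rV[R]_n -> R) :
  {in r, forall i, is_polyfun d (F i)} ->
  is_polyfun d (fun x => \sum_(i <- r) F i x).
Proof.
elim: r => [|i r IH] Fd.
  rewrite (_ : (fun=> _) = fun=> 0); first exact: is_polyfun0.
  by apply/funext => x; rewrite big_nil.
rewrite (_ : (fun=> _) = fun x => F i x + \sum_(j <- r) F j x).
  apply: is_polyfunD; first by apply: Fd; rewrite mem_head.
  by apply: IH => j jr; apply: Fd; rewrite inE jr orbT.
by apply/funext => x; rewrite big_cons.
Qed.

Definition monomial_fun (m : mpoly.multinom n) x : R :=
  \prod_(i < n) x ord0 i ^+ m i.

Lemma is_polyfun_monomial (m : mpoly.multinom n) :
  is_polyfun (mpoly.mdeg m).+1 (monomial_fun m).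
Proof.
exists (mpoly.mpolyX R m); split=> [|x]; first by rewrite mpoly.msizeX.
by rewrite /polyfun mpoly.mevalX.
Qed.

Lemma polyfunE P x : polyfun P x =
  \sum_(m <- mpoly.msupp P) mpoly.mcoeff m P * monomial_fun m x.
Proof. by rewrite /polyfun mpoly.mevalE. Qed.

Definition drop_coord (j : 'I_n) x : 'rV[R]_n := x - x ord0 j *: delta_mx ord0 j.

Lemma drop_coordE j x i : drop_coord j x ord0 i = if i == j then 0 else x ord0 i.
Proof.
rewrite !mxE eqxx /=; case: eqP => [->|_]; first by rewrite mulr1 subrr.
by rewrite mulr0 subr0.
Qed.

Lemma drop_coord_lineE j x (t : R) i :
  (drop_coord j x + t *: delta_mx ord0 j) ord0 i = if i == j then t else x ord0 i.
Proof.
rewrite mxE drop_coordE !mxE eqxx /=; case: eqP => _; first by rewrite mulr1 add0r.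
by rewrite mulr0 addr0.
Qed.

Lemma monomial_fun_line m j x (t : R) :
  monomial_fun m (drop_coord j x + t *: delta_mx ord0 j) =
  t ^+ m j * \prod_(i < n | i != j) x ord0 i ^+ m i.
Proof.
rewrite /monomial_fun (bigD1 j) //= drop_coord_lineE eqxx; congr (_ * _).
by apply: eq_bigr => i ij; rewrite drop_coord_lineE (negbTE ij).
Qed.

(** Setting coordinate [j] to 0 kills the monomials that contain it and fixes the others. *)
Lemma is_polyfun_drop_coord d j q : is_polyfun d q ->
  is_polyfun d (fun x => q (drop_coord j x)).
Proof.
move=> [P [Pd qP]].
rewrite (_ : (fun x => _) = fun x => \sum_(m <- mpoly.msupp P)
    mpoly.mcoeff m P * monomial_fun m (drop_coord j x)); last first.
  by apply/funext => x; rewrite qP polyfunE.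
apply: is_polyfun_sum => m mP; apply: is_polyfunZ.
have md := leq_trans (mpoly.msize_mdeg_lt mP) Pd.
have dropE x : monomial_fun m (drop_coord j x) =
    0 ^+ m j * \prod_(i < n | i != j) x ord0 i ^+ m i.
  by rewrite -monomial_fun_line scale0r addr0.
case: (posnP (m j)) => mj.
  apply: (is_polyfun_leq md); rewrite (_ : (fun x => _) = monomial_fun m).
    exact: is_polyfun_monomial.
  apply/funext => x; rewrite dropE /monomial_fun [in RHS](bigD1 j) //=.
  by rewrite mj !expr0.
rewrite (_ : (fun x => _) = fun=> 0); first exact: is_polyfun0.
by apply/funext => x; rewrite dropE expr0n (gtn_eqF mj) mul0r.
Qed.

(** Integrating term by term, each monomial gains one factor of coordinate [j]. *)
Lemma is_polyfun_primitive d j q : is_polyfun d q ->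
  is_polyfun d.+1 (fun x =>
    primitive (fun t => q (drop_coord j x + t *: delta_mx ord0 j)) (x ord0 j)).
Proof.
move=> [P [Pd qP]].
rewrite (_ : (fun x => _) = fun x => \sum_(m <- mpoly.msupp P)
    mpoly.mcoeff m P / (m j).+1%:R *
    monomial_fun (mpoly.mnm_add m (mpoly.mnm1 j)) x).
  apply: is_polyfun_sum => m mP; apply: is_polyfunZ.
  have md := leq_trans (mpoly.msize_mdeg_lt mP) Pd.
  apply: is_polyfun_leq (is_polyfun_monomial _).
  by rewrite mpoly.mdegD mpoly.mdeg1 addn1 ltnS.
apply/funext => x.
pose C (m : mpoly.multinom n) := \prod_(i < n | i != j) x ord0 i ^+ m i.
rewrite (_ : (fun t => _) = fun t => \sum_(m <- mpoly.msupp P)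
    mpoly.mcoeff m P * C m * t ^+ m j); last first.
  apply/funext => t; rewrite qP polyfunE; apply: eq_bigr => m _.
  by rewrite monomial_fun_line -/(C m); ring.
rewrite primitive_sum => [|m t]; last first.
  by apply: cvgM; [exact: cvg_cst|exact: exprn_continuous].
apply: eq_bigr => m _; rewrite primitive_monomial /monomial_fun.
rewrite [in RHS](bigD1 j) //= mpoly.mnmDE mpoly.mnm1E eqxx addn1.
rewrite (eq_bigr (fun i => x ord0 i ^+ m i)) -/(C m); first by ring.
by move=> i ij; rewrite mpoly.mnmDE mpoly.mnm1E eq_sym (negbTE ij) addn0.
Qed.

Lemma drop_all_coords x : foldl (fun y j => drop_coord j y) x (enum 'I_n) = 0.
Proof.
have dropE r y i : foldl (fun y j => drop_coord j y) y r ord0 i =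
    if i \in r then 0 else y ord0 i.
  elim: r y => //= j r IH y; rewrite IH drop_coordE inE.
  by case: eqP; case: (i \in r).
by apply/rowP => i; rewrite dropE mem_enum mxE.
Qed.

(** Induction on [d]: the mean and the difference of [q] along an axis are polynomials by induction,
    so by [line_formula] setting one coordinate to 0 changes [q] by a polynomial. Doing so for all
    coordinates in turn leaves the constant [q 0]. *)
Lemma annihilated_is_polyfun d q : continuous q ->
  annihilated (nseq d setT) q -> is_polyfun d q.
Proof.
elim: d q => [|d IH] q qc qD.
  by rewrite (_ : q = fun=> 0); [exact: is_polyfun0|exact/funext].
have dropd j : is_polyfun d.+1 (fun x => q x - q (drop_coord j x)).
  pose c : 'rV[R]_n := delta_mx ord0 j.
  have Ud : is_polyfun d (mean_fdiff c q).
    apply: IH; first exact: mean_fdiff_continuous.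
    exact: (annihilated_mean_fdiff qc _ qD).
  have Vd : is_polyfun d (fdiff c q).
    by apply: IH; [exact: fdiff_continuous|exact: qD].
  rewrite (_ : (fun x => _) = fun x =>
      (mean_fdiff c q (drop_coord j x) + - mean_fdiff c q x) +
      primitive (fun t => fdiff c q (drop_coord j x + t *: c)) (x ord0 j)).
    apply: is_polyfunD; last exact: is_polyfun_primitive.
    apply: (is_polyfun_leq (leqnSn d)).
    by apply: is_polyfunD; [exact: is_polyfun_drop_coord|exact: is_polyfunN].
  apply/funext => x; have := line_formula c (drop_coord j x) (x ord0 j) qc.
  by rewrite [in LHS]subrK [in X in _ - X]subrK => ->; ring.
have dropsd r : is_polyfun d.+1
    (fun x => q x - q (foldl (fun y j => drop_coord j y) x r)).
  elim: r => [|j r IHr] /=.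
    rewrite (_ : (fun x => _) = fun=> 0); first exact: is_polyfun0.
    by apply/funext => x; rewrite subrr.
  rewrite (_ : (fun x => _) = fun x => (q x - q (drop_coord j x)) +
      (q (drop_coord j x) -
       q (foldl (fun y i => drop_coord i y) (drop_coord j x) r))).
    by apply: is_polyfunD; last exact: (is_polyfun_drop_coord j IHr).
  by apply/funext => x; rewrite addrA subrK.
rewrite (_ : q = fun x =>
    (q x - q (foldl (fun y j => drop_coord j y) x (enum 'I_n))) + q 0).
  by apply: is_polyfunD; [exact: dropsd|exact: is_polyfun_cst].
by apply/funext => x; rewrite drop_all_coords subrK.
Qed.

End PolynomialFunctions.

(** * Reduction to a generic plane *)

Section InnerProduct.
Variables (R : realType) (n : nat).
Implicit Types (u v x y : 'rV[R]_n).

Lemma dotvDr u x y : dotv u (x + y) = dotv u x + dotv u y.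
Proof.
by rewrite /dotv -big_split; apply: eq_bigr => j _; rewrite mxE mulrDr.
Qed.

Lemma dotvZr u (c : R) x : dotv u (c *: x) = c * dotv u x.
Proof.
by rewrite /dotv mulr_sumr; apply: eq_bigr => j _; rewrite mxE mulrCA.
Qed.

Lemma dotvC u x : dotv u x = dotv x u.
Proof. by apply: eq_bigr => j _; rewrite mulrC. Qed.

Lemma dotv_continuous u : continuous (dotv u).
Proof.
suff : continuous (fun x => \sum_(j < n) u ord0 j * x ord0 j) by [].
apply: continuous_big => [|j _]; first exact: add_continuous.
have cj : continuous (fun x : 'rV[R]_n => x ord0 j) by exact: coord_continuous.
by move=> x; apply: (@cvgM _ _ (nbhs x)); [exact: cvg_cst|exact: cj].
Qed.

Lemma exists_nonroot (p : {poly R}) : p != 0 -> exists t, p.[t] != 0.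
Proof.
move=> p0; apply: contrapT => /forallNP roots.
have : (size [seq k%:R : R | k <- iota 0 (size p)] < size p)%N.
  apply: max_poly_roots => //.
    by apply/allP => t _; apply: contrapT => /negP; exact: roots.
  by rewrite map_inj_uniq ?iota_uniq // => k l /eqP; rewrite eqr_nat => /eqP.
by rewrite size_map size_iota ltnn.
Qed.

(* A point of the moment curve t |-> (1, t, ..., t^(n-1)) works, because every
   hyperplane through 0 meets the curve in finitely many points. *)
Lemma exists_nonorthogonal (J : finType) (v : J -> 'rV[R]_n) :
  (forall i, v i != 0) -> exists b, forall i, dotv (v i) b != 0.
Proof.
move=> v0.
have [t /[!horner_prod]/prodf_neq0 tP] :
    exists t, (\prod_i rVpoly (v i)).[t] != 0.
  apply: exists_nonroot; apply/prodf_neq0 => i _.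
  by apply: contra (v0 i) => /eqP p0; rewrite -[v i]rVpolyK p0 linear0.
exists (\row_j t ^+ j) => i; have := tP i isT.
rewrite horner_poly; congr (_ != 0); apply: eq_bigr => j _.
by rewrite mxE insubT //= => jn; congr (v i _ _ * _); exact: val_inj.
Qed.

Lemma free_pair_comb u v (c e : R) :
  free [:: u; v] -> c != 0 -> c *: u + e *: v != 0.
Proof.
rewrite free_cons => /andP[uv _] c0; apply: contra uv; rewrite addr_eq0 => /eqP cu.
rewrite span_seq1 -[u](scalerK c0) cu.
by rewrite memvZ // memvN memvZ // memv_line.
Qed.

End InnerProduct.

Lemma ridge_sum_generic (R : realType) (n k : nat) (a : 'I_k -> 'rV[R]_n)
    (a_indep : pairwise_independent a) (a_neq0 : forall i, a i != 0)
    (f : 'rV[R]_n -> R) (f_cont : continuous f) (fs : 'I_k -> R -> R)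
    (f_sum : forall x, f x = \sum_(i < k) fs i (dotv (a i) x)) :
  exists (g : 'I_k -> R -> R) (P : mpoly n R),
    [/\ forall i : 'I_k, continuous (g i), tdegree_lt k P
      & forall x, f x = \sum_(i < k) g i (dotv (a i) x) + polyfun P x].
Proof.
have [b b0] := exists_nonorthogonal a_neq0.
pose beta i := dotv (a i) b.
(* For i != j, [d] is orthogonal to [w (i, j)] exactly when [lam i = lam j]. The diagonal value only
   serves to make every [w ij] nonzero. *)
pose w (ij : 'I_k * 'I_k) := if ij.1 == ij.2 then a ij.1
  else beta ij.2 *: a ij.1 + - beta ij.1 *: a ij.2.
have w0 ij : w ij != 0.
  rewrite /w; case: (eqVneq ij.1 ij.2) => [_|ij12]; first exact: a_neq0.
  apply: free_pair_comb.
    exact: a_indep.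
  exact: b0.
have [d d0] := exists_nonorthogonal w0.
pose lam i := dotv (a i) d / beta i.
have lam_inj : injective lam.
  move=> i j /eqP lij; apply/eqP; apply: contraTT lij => ij.
  have := d0 (i, j); rewrite /w /= (negbTE ij); apply: contra.
  rewrite /lam eqr_div ?b0 // => /eqP e.
  rewrite dotvC dotvDr !dotvZr ![dotv d _]dotvC mulNr [X in X - _]mulrC e.
  by rewrite mulrC subrr.
pose F p := f (p.1 *: b + p.2 *: d).
have Fc : continuous F.
  apply: (@comp_continuous (R * R)%type _ R (fun p => p.1 *: b + p.2 *: d) f) => //.
  by move=> p; apply: cvgD; apply: cvgZr_tmp; [exact: cvg_fst|exact: cvg_snd].
(* On the plane spanned by [b] and [d], the form given by [a i] is [beta i] times [tilt lam i]; the
   factor is absorbed here and undone in [g]. *)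
pose phi i y := fs i (beta i * y).
have FE p : F p = \sum_(i <- enum 'I_k) phi i (tilt lam i p).
  rewrite /F f_sum big_enum /=; apply: eq_bigr => i _; rewrite /phi /tilt.
  rewrite dotvDr !dotvZr /lam; congr (fs i _); rewrite -/(beta i).
  by field; exact: b0.
have [G [Gc GE]] : exists G : 'I_k -> R -> R, (forall i, continuous (G i)) /\
    forall p, F p = \sum_(i <- enum 'I_k) G i (tilt lam i p).
  apply: (continuous_plane_ridge lam_inj) => //; first exact: enum_uniq.
  by rewrite (funext FE); exact: ridge_annihilated.
pose psi i y := phi i y - G i y.
(* The ridges [psi i] sum to 0 on the plane, and [j] has k - 1 competitors there. *)
have psiD j : annihilated (nseq k.-1 setT) (psi j).
  have jk : j \in enum 'I_k by rewrite mem_enum.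
  have ->: k.-1 = size (rem j (enum 'I_k)) by rewrite size_rem // size_enum_ord.
  apply: (vanishing_ridge_sum lam_inj) => [|p].
    by rewrite -(perm_uniq (perm_to_rem jk)) enum_uniq.
  by rewrite -(perm_big _ (perm_to_rem jk)) sumrB -FE -GE subrr.
pose g i y := G i (y / beta i).
have gc i : continuous (g i).
  apply: (@comp_continuous R R R (fun y => y / beta i) (G i)) => // y.
  by apply: cvgM; [exact: cvg_id|exact: cvg_cst].
have [P [Pk PE]] : is_polyfun k.-1
    (fun x => f x - \sum_(i < k) g i (dotv (a i) x)).
  apply: annihilated_is_polyfun.
    have sc : continuous (fun x => \sum_(i < k) g i (dotv (a i) x)).
      apply: continuous_big => [|i _]; first exact: add_continuous.
      by apply: (comp_continuous _ (gc i)); exact: dotv_continuous.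
    by move=> x; apply: (@cvgB _ _ _ (nbhs x)); [exact: f_cont|exact: sc].
  (* Continuity has been obtained for the whole sum, since a single [psi i] may be discontinuous;
     the differences are applied term by term. *)
  rewrite (_ : (fun x => _) = fun x =>
      \sum_(i < k) psi i (dotv (a i) x / beta i)).
    apply: annihilated_sum => i.
    apply: (annihilated_comp (L := fun x => dotv (a i) x / beta i)) => // x y.
    by rewrite dotvDr mulrDl.
  apply/funext => x; rewrite f_sum -sumrB; apply: eq_bigr => i _.
  by rewrite /psi /phi /g mulrCA divff ?mulr1 // b0.
exists g, P; split=> // [|x]; first exact: leq_trans (leq_pred k).
by rewrite -PE addrC subrK.
Qed.

Theorem theorem4p1 (R : realType) (n k : nat) (a : 'I_k -> 'rV[R]_n)
    (a_indep : pairwise_independent a)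
    (f : 'rV[R]_n -> R) (f_cont : continuous f)
    (fs : 'I_k -> R -> R)
    (f_sum : forall x : 'rV[R]_n, f x = \sum_(i < k) fs i (dotv (a i) x)) :
  exists (g : 'I_k -> R -> R) (P : mpoly n R),
    [/\ forall i : 'I_k, continuous (g i),
        tdegree_lt k P
      & forall x : 'rV[R]_n,
          f x = \sum_(i < k) g i (dotv (a i) x) + polyfun P x].
Proof.
have [a_neq0|/existsNP[i /negP/negPn/eqP ai0]] := pselect (forall i, a i != 0).
  exact: ridge_sum_generic f_sum.
(* A pair containing the zero vector is not free, so [i] is the only index and [f] is constant. *)
have only_i j : j = i.
  apply: contrapT => /eqP ji; have := a_indep _ _ ji.
  by rewrite free_cons seq1_free ai0 eqxx andbF.
exists (fun j _ => fs j 0), 0; split=> [j||x]; first exact: cst_continuous.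
  by rewrite /tdegree_lt mpoly.msize0.
rewrite /polyfun mpoly.meval0 addr0 f_sum; apply: eq_bigr => j _; congr (fs j _).
by rewrite (only_i j) ai0 dotvC -(scale0r 0) dotvZr mul0r.
Qed.
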